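(* Let $\Gamma$ be a set of conditions and $\phi$ a proposition. If $\Gamma\vDash 0\leqslant\phi$, then $\Gamma\vdash-\frac1n\leqslant\phi$ for all integers $n\geqslant1$.
   Context: Syntax. Fix a countable set $\mathbb P$ of atomic propositions. (Affine) propositions are built inductively: $1$, every $p\in\mathbb P$, $\phi+\psi$, $r\phi$ ($r\in\mathbb R$), $\Box\phi$. Abbreviations: a real number $r$ used as a proposition means $r1$ (so $0$ is $0\cdot 1$); $-\phi$ is $(-1)\phi$; $\phi-\psi$ is $\phi+(-1)\psi$. A condition is an expression $\phi\leqslant\psi$ with $\phi,\psi$ propositions; $\phi=\psi$ stands for the two conditions $\phi\leqslant\psi$, $\psi\leqslant\phi$. A theory is a set of conditions. Proof system. Logical axioms (for all propositions $\phi,\psi,\theta$ and reals $r,s$): (A1) $r\leqslant s$, whenever $r\leqslant s$ holds in $\mathbb R$; (A2) $\phi+(\psi+\theta)=(\phi+\psi)+\theta$; (A3) $\phi+\psi=\psi+\phi$; (A4) $0+\phi=\phi$; (A5) $r(\phi+\psi)=r\phi+r\psi$; (A6) $(r+s)\phi=r\phi+s\phi$; (A7) $r(s\phi)=(rs)\phi$; (A8) $1\phi=\phi$; (A9) $0\phi=0$; (A10) $0\leqslant p$ and $p\leqslant 1$ for $p\in\mathbb P$; (A11) $\Box(\phi-\psi)\leqslant\Box\phi-\Box\psi$; (A12) $\Box\phi\leqslant\phi$; (A13) $\Box\phi\leqslant\Box\Box\phi$; (A14) $\Box(r\phi)=r\Box\phi$ for $r\geqslant0$; (A15) $\Box r=r$.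 Rules: (R1) from $\phi\leqslant\psi$ infer $\phi+\theta\leqslant\psi+\theta$; (R2) from $0\leqslant r$ and $\phi\leqslant\psi$ infer $r\phi\leqslant r\psi$; (R3) from $\phi\leqslant\psi$ and $\psi\leqslant\theta$ infer $\phi\leqslant\theta$; (R4) from $\phi\leqslant\psi$ infer $\Box\phi\leqslant\Box\psi$. $\Vdash\mathcal S$ means that the condition $\mathcal S$ is derivable from the logical axioms by finitely many applications of (R1)-(R4). For a theory $\Gamma$: $\Gamma\vdash_0\mathcal S$ if $\Vdash\mathcal S$ or $\mathcal S\in\Gamma$; for $n>0$, $\Gamma\vdash_n\mathcal S$ if for some $k<n$ either $\Gamma\vdash_k\mathcal S$ or $\mathcal S$ follows by one application of (R1), (R2) or (R3) (not (R4)) from conditions $\mathcal S'$ with $\Gamma\vdash_k\mathcal S'$. $\Gamma\vdash\mathcal S$ means $\Gamma\vdash_n\mathcal S$ for some $n$. Semantics. A topological model is a pair $M=(X,\mathbf v)$ with $X$ a topological space and $\mathbf v$ assigning to each $p\in\mathbb P$ an arbitrary map $\mathbf v_p:X\to[0,1]$. The value $\phi^M:X\to\mathbb R$ is defined by $1^M(x)=1$, $p^M(x)=\mathbf v_p(x)$, $(\phi+\psi)^M=\phi^M+\psi^M$, $(r\phi)^M=r\phi^M$, and $(\Box\phi)^M(x)=\sup\{\inf_{t\in U}\phi^M(t): U\ni x \text{ open}\}$ (the lower semi-continuous envelope of $\phi^M$). $M\vDash_x\phi\leqslant\psi$ means $\phi^M(x)\leqslant\psi^M(x)$; $M\vDash_x\Gamma$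 means $M\vDash_x\mathcal S$ for all $\mathcal S\in\Gamma$. $\Gamma\vDash\phi\leqslant\psi$ means: for every topological model $M=(X,\mathbf v)$ and every $x\in X$, if $M\vDash_x\Gamma$ then $M\vDash_x\phi\leqslant\psi$. *)

(* Defs.v *)
From HB Require Import structures.
From mathcomp Require Import all_boot all_order all_algebra.
From mathcomp Require Import all_classical all_reals.
From mathcomp Require Import topology.

Set Implicit Arguments.
Unset Strict Implicit.
Unset Printing Implicit Defensive.

Import Order.TTheory GRing.Theory Num.Theory.

Local Open Scope classical_set_scope.
Local Open Scope ring_scope.

Inductive affprop (R : realType) (P : countType) : Type :=
| AOne
| AAtom of P
| AAdd of affprop R P & affprop R P
| AScale of R & affprop R P
| ABox of affprop R P.

Arguments AOne {R P}.
Arguments AAtom {R P} p.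
Arguments AAdd {R P} phi psi.
Arguments AScale {R P} r phi.
Arguments ABox {R P} phi.

Declare Scope affprop_scope.
Delimit Scope affprop_scope with A.
Bind Scope affprop_scope with affprop.

Definition areal {R : realType} {P : countType} (r : R) : affprop R P :=
  AScale r AOne.

Notation "phi + psi" := (AAdd phi%A psi%A) : affprop_scope.
Notation "r *: phi" := (AScale r%R phi%A) : affprop_scope.
Notation "- phi" := (AScale (-1)%R phi%A) : affprop_scope.
Notation "phi - psi" := (AAdd phi%A (AScale (-1)%R psi%A)) : affprop_scope.
Notation "[box] phi" :=
  (ABox phi%A) (at level 35, right associativity) : affprop_scope.

Record condition (R : realType) (P : countType) : Type :=
  Cond { lhs : affprop R P ; rhs : affprop R P }.

Arguments Cond {R P} lhs%_A rhs%_A.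

Declare Scope condition_scope.
Delimit Scope condition_scope with C.
Bind Scope condition_scope with condition.
Notation "phi <= psi" := (Cond phi%A psi%A) : condition_scope.

Definition eq_conds {R : realType} {P : countType} (phi psi : affprop R P) :
  set (condition R P) := [set (phi <= psi)%C; (psi <= phi)%C].

Notation theory R P := (set (condition R P)).

(* Each equational axiom contributes both conditions in [eq_conds]. *)
Inductive logical_axiom (R : realType) (P : countType) :
    condition R P -> Prop :=
| A1 (r s : R) : r <= s -> logical_axiom (areal r <= areal s)%C
| A2 phi psi theta c :
    eq_conds (phi + (psi + theta))%A ((phi + psi) + theta)%A c ->
    logical_axiom c
| A3 phi psi c : eq_conds (phi + psi)%A (psi + phi)%A c -> logical_axiom c
| A4 phi c : eq_conds (areal 0 + phi)%A phi c -> logical_axiom c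
| A5 (r : R) phi psi c :
    eq_conds (r *: (phi + psi))%A (r *: phi + r *: psi)%A c -> logical_axiom c
| A6 (r s : R) phi c :
    eq_conds ((r + s)%R *: phi)%A (r *: phi + s *: phi)%A c -> logical_axiom c
| A7 (r s : R) phi c :
    eq_conds (r *: (s *: phi))%A ((r * s)%R *: phi)%A c -> logical_axiom c
| A8 phi c : eq_conds (1 *: phi)%A phi c -> logical_axiom c
| A9 phi c : eq_conds (0 *: phi)%A (areal 0) c -> logical_axiom c
| A10_ge0 p : logical_axiom (areal 0 <= AAtom p)%C
| A10_le1 p : logical_axiom (AAtom p <= AOne)%C
| A11 phi psi : logical_axiom ([box] (phi - psi) <= [box] phi - [box] psi)%C
| A12 phi : logical_axiom ([box] phi <= phi)%C
| A13 phi : logical_axiom ([box] phi <= [box] [box] phi)%C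
| A14 (r : R) phi c : 0 <= r ->
    eq_conds ([box] (r *: phi))%A (r *: [box] phi)%A c -> logical_axiom c
| A15 (r : R) c : eq_conds ([box] (areal r))%A (areal r) c -> logical_axiom c.

(* [affine_rule H c]: [c] follows from the set of premises [H] by a single
   rule that does not involve the modality. *)
Inductive affine_rule (R : realType) (P : countType) :
    set (condition R P) -> condition R P -> Prop :=
| R1 phi psi theta :
    affine_rule [set (phi <= psi)%C] (phi + theta <= psi + theta)%C
| R2 (r : R) phi psi :
    affine_rule [set (areal 0 <= areal r)%C; (phi <= psi)%C]
                (r *: phi <= r *: psi)%C
| R3 phi psi theta :
    affine_rule [set (phi <= psi)%C; (psi <= theta)%C] (phi <= theta)%C.

Inductive provable (R : realType) (P : countType) : condition R P -> Prop :=
| provable_axiom c : logical_axiom c -> provable c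
| provable_affine H c :
    affine_rule H c -> (forall d, H d -> provable d) -> provable c
| provable_R4 phi psi :
    provable (phi <= psi)%C -> provable ([box] phi <= [box] psi)%C.

Inductive proves_in (R : realType) (P : countType) (Gamma : theory R P) :
    nat -> condition R P -> Prop :=
| proves_in0 c : provable c \/ Gamma c -> proves_in Gamma 0 c
| proves_in_lt n k c : (k < n)%N -> proves_in Gamma k c -> proves_in Gamma n c
| proves_in_rule n k H c : (k < n)%N -> affine_rule H c ->
    (forall d, H d -> proves_in Gamma k d) -> proves_in Gamma n c.

Definition proves (R : realType) (P : countType) (Gamma : theory R P)
  (c : condition R P) : Prop := exists n, proves_in Gamma n c.

Record topmodel (R : realType) (P : countType) : Type := TopModel {
  space :> topologicalType ;
  valuation : P -> space -> R ;
  valuation_itv : forall p x, 0 <= valuation p x <= 1 }.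

(* The lower semi-continuous envelope. The real-valued [sup] and [inf] are only
   meaningful on nonempty bounded sets; see [value_bounded]. *)
Definition lsc_env (R : realType) (X : topologicalType) (f : X -> R) (x : X) :
  R := sup [set inf (f @` U) | U in [set U : set X | open U /\ U x]].

Fixpoint value (R : realType) (P : countType) (M : topmodel R P)
    (phi : affprop R P) : M -> R :=
  match phi with
  | AOne => fun=> 1
  | AAtom p => valuation p
  | AAdd phi psi => fun x => value phi x + value psi x
  | AScale r phi => fun x => r * value phi x
  | ABox phi => lsc_env (value phi)
  end.

Arguments value {R P} M phi%_A x.

Definition sat_cond (R : realType) (P : countType) (M : topmodel R P) (x : M)
  (c : condition R P) : Prop := value M (lhs c) x <= value M (rhs c) x.

Definition sat_theory (R : realType) (P : countType) (M : topmodel R P) (x : M)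
  (Gamma : theory R P) : Prop := forall c, Gamma c -> sat_cond x c.

Definition entails (R : realType) (P : countType) (Gamma : theory R P)
  (c : condition R P) : Prop :=
  forall (M : topmodel R P) (x : M), sat_theory x Gamma -> sat_cond x c.

Lemma lsc_env_bounded (R : realType) (X : topologicalType) (f : X -> R)
    (K : R) : (forall x, `|f x| <= K) -> forall x, `|lsc_env f x| <= K.
Proof.
move=> fK x.
have infK (U : set X) : U x -> - K <= inf (f @` U) <= K.
  move=> Ux; apply/andP; split.
    apply: lb_le_inf; first by exists (f x), x.
    by move=> _ [y _ <-]; have := fK y; rewrite ler_norml => /andP[].
  apply: (@le_trans _ _ (f x)).
    apply: ge_inf; last by exists x.
    by exists (- K) => _ [y _ <-]; have := fK y; rewrite ler_norml => /andP[].
  by have := fK x; rewrite ler_norml => /andP[].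
have ubK : ubound [set inf (f @` U) | U in [set U : set X | open U /\ U x]] K.
  by move=> _ [U [_ Ux] <-]; case/andP: (infK _ Ux).
have inT : [set inf (f @` U) | U in [set U : set X | open U /\ U x]]
    (inf (f @` setT)).
  by exists setT => //; split => //; exact: openT.
rewrite ler_norml; apply/andP; split.
  have /andP[leK _] := infK setT I.
  by apply: le_trans leK _; apply: ub_le_sup => //; exists K.
by apply: ge_sup => //; exists (inf (f @` setT)).
Qed.

Lemma value_bounded (R : realType) (P : countType) (M : topmodel R P)
    (phi : affprop R P) : exists K : R, forall x : M, `|value M phi x| <= K.
Proof.
elim: phi => [|p|phi [K HK] psi [L HL]|r phi [K HK]|phi [K HK]] /=.
- by exists 1 => x; rewrite normr1.
- by exists 1 => x; case/andP: (valuation_itv p x) => ge0 le1; rewrite ger0_norm.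
- by exists (K + L) => x; rewrite (le_trans (ler_normD _ _)) ?lerD.
- by exists (`|r| * K) => x; rewrite normrM ler_wpM2l.
- by exists K; exact: lsc_env_bounded.
Qed.

(* Main.v *)
Require Import Defs.
From HB Require Import structures.
From mathcomp Require Import all_boot all_order all_algebra.
From mathcomp Require Import all_classical all_reals.
From mathcomp Require Import topology.
From mathcomp Require Import ring lra.

Set Implicit Arguments.
Unset Strict Implicit.
Unset Printing Implicit Defensive.

Import Order.TTheory GRing.Theory Num.Theory.

Local Open Scope classical_set_scope.
Local Open Scope ring_scope.

(** The proof builds one model that refutes every underivable bound. Its points
are the states: the real-valued linear maps [T] on propositions with [T 1 = 1]
that are monotone for provability, that is, the normalized positive functionals
on the ordered vector space of propositions modulo provable equality. An atom
[p] takes the value [T p] at [T].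

States are plentiful ([separation]): if [a <= phi] is not derivable from
[Gamma], some state satisfies [Gamma] and has [T phi <= a]. This is a
Hahn-Banach theorem, proved here as a Lindenbaum lemma. A theory maximal among
those not deriving [a <= phi] compares any two propositions, by the [deduction]
theorem; since every proposition lies between two real constants, such a total
theory assigns to each proposition the real number that it cuts out, and this
assignment is a state.

The topology is that of the up-closed sets for the preorder [box_le], in which
[T] is below [S] when [T (box psi) <= S (box psi)] for all [psi]. Every state
[T] has a least neighbourhood, namely the set of [S] above [T], so the envelope
of [S |-> S phi] at [T] is the infimum of [S phi] over these [S]. It is at least
[T (box phi)] because [T (box phi) <= S (box phi) <= S phi]. For the converse,
the conditions [a <= b] with [0 <= T (box (b - a))] form a theory closed under
the affine rules, as the box is superadditive, so this theory cannot derive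
[T (box phi) + e <= phi] with [e > 0]; the state given by [separation] lies
above [T] and takes at [phi] a value at most [T (box phi) + e] ([box_witness]).
Hence [canonical_truth]: the value of [phi] at [T] is [T phi].

If [-1/n <= phi] is not derivable from [Gamma], a state satisfying [Gamma] with
[T phi <= -1/n < 0] is then a point of the model where [Gamma] holds and
[0 <= phi] fails.

Linear manipulations inside the calculus are reduced to arithmetic over the
scalars by [provable_linear]: two propositions with the same image under every
linear form are provably equal. *)

(** * Derivability as a closure *)

Section Derivability.
Variables (R : realType) (P : countType).
Implicit Types (phi psi theta : affprop R P) (c d : condition R P).
Implicit Types (Gamma Delta : theory R P).

Lemma provable_R1 phi psi theta :
  provable (phi <= psi)%C -> provable (phi + theta <= psi + theta)%C.
Proof. by move=> ?; apply: provable_affine (R1 _ _ _) _ => d ->. Qed.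

Lemma provable_scale (r : R) phi psi : 0 <= r ->
  provable (phi <= psi)%C -> provable (r *: phi <= r *: psi)%C.
Proof.
move=> r0 h; apply: provable_affine (R2 _ _ _) _ => d [->|->//].
exact/provable_axiom/A1.
Qed.

Lemma provable_R3 phi psi theta : provable (phi <= psi)%C ->
  provable (psi <= theta)%C -> provable (phi <= theta)%C.
Proof.
by move=> h k; apply: provable_affine (R3 phi psi theta) _ => d [->|->].
Qed.

(** Induction on derivations with the stage counter forgotten; each use below
checks that a class of conditions is closed under the affine rules. *)
Lemma proves_elim Gamma (Q : condition R P -> Prop) :
  (forall c, provable c -> Q c) ->
  (forall c, Gamma c -> Q c) ->
  (forall phi psi theta,
    Q (phi <= psi)%C -> Q (phi + theta <= psi + theta)%C) ->
  (forall r phi psi, Q (areal 0 <= areal r)%C -> Q (phi <= psi)%C ->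
    Q (r *: phi <= r *: psi)%C) ->
  (forall phi psi theta, Q (phi <= psi)%C -> Q (psi <= theta)%C ->
    Q (phi <= theta)%C) ->
  forall c, proves Gamma c -> Q c.
Proof.
move=> Qp QG Q1 Q2 Q3 c [n]; elim=> {n c} [c [/Qp|/QG]//|//|n k H c _ rH _ IH].
case: rH IH => [phi psi theta|r phi psi|phi psi theta] IH.
- by apply: Q1; exact: IH.
- by apply: Q2; apply: IH; [left|right].
- by apply: (Q3 _ psi); apply: IH; [left|right].
Qed.

Lemma provable_proves Gamma c : provable c -> proves Gamma c.
Proof. by move=> ?; exists 0; apply: proves_in0; left. Qed.

Lemma proves_hyp Gamma c : Gamma c -> proves Gamma c.
Proof. by move=> ?; exists 0; apply: proves_in0; right. Qed.

Lemma proves_R1 Gamma phi psi theta :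
  proves Gamma (phi <= psi)%C -> proves Gamma (phi + theta <= psi + theta)%C.
Proof.
move=> [n h]; exists n.+1.
by apply: proves_in_rule (ltnSn n) (R1 _ _ _) _ => d ->.
Qed.

(** Premises derived at different stages are brought to a common stage. *)
Lemma proves_rule2 Gamma c1 c2 c : affine_rule [set c1; c2] c ->
  proves Gamma c1 -> proves Gamma c2 -> proves Gamma c.
Proof.
move=> rule [m h] [n k]; exists (maxn m n).+2.
apply: proves_in_rule (ltnSn _) rule _ => d [->|->].
- by apply: proves_in_lt h; rewrite ltnS leq_maxl.
- by apply: proves_in_lt k; rewrite ltnS leq_maxr.
Qed.

Lemma proves_R2 Gamma (r : R) phi psi : proves Gamma (areal 0 <= areal r)%C ->
  proves Gamma (phi <= psi)%C -> proves Gamma (r *: phi <= r *: psi)%C.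
Proof. exact/proves_rule2/R2. Qed.

Lemma proves_scale Gamma (r : R) phi psi : 0 <= r ->
  proves Gamma (phi <= psi)%C -> proves Gamma (r *: phi <= r *: psi)%C.
Proof. by move=> r0; apply/proves_R2/provable_proves/provable_axiom/A1. Qed.

Lemma proves_R3 Gamma phi psi theta : proves Gamma (phi <= psi)%C ->
  proves Gamma (psi <= theta)%C -> proves Gamma (phi <= theta)%C.
Proof. exact/proves_rule2/R3. Qed.

Lemma proves_sub Gamma Delta c :
  Gamma `<=` Delta -> proves Gamma c -> proves Delta c.
Proof.
move=> sub; apply: proves_elim.
- by move=> *; exact: provable_proves.
- by move=> d /sub; exact: proves_hyp.
- exact: proves_R1.
- exact: proves_R2.
- exact: proves_R3.
Qed.

Lemma proves0 c : proves set0 c -> provable c.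
Proof.
apply: proves_elim => //.
- exact: provable_R1.
- by move=> r phi psi h k; apply: provable_affine (R2 _ _ _) _ => d [->|->].
- exact: provable_R3.
Qed.

End Derivability.

(** * Linear reasoning inside the calculus *)

HB.instance Definition _ (R : realType) (P : countType) :=
  gen_eqMixin (affprop R P).

Section Linear.
Variables (R : realType) (P : countType).
Implicit Types (phi psi theta g : affprop R P) (s : seq (affprop R P)).
Implicit Types (Gamma : theory R P).

Definition equiv phi psi := provable (phi <= psi)%C /\ provable (psi <= phi)%C.

Lemma equiv_axiom phi psi :
  (forall c, eq_conds phi psi c -> logical_axiom c) -> equiv phi psi.
Proof. by move=> h; split; apply/provable_axiom/h; [left|right]. Qed.

Lemma equiv_sym phi psi : equiv phi psi -> equiv psi phi.
Proof. by case. Qed.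

Lemma equiv_trans psi phi theta :
  equiv phi psi -> equiv psi theta -> equiv phi theta.
Proof. by move=> [h1 h2] [k1 k2]; split; apply: provable_R3; eassumption. Qed.

Lemma equiv_refl phi : equiv phi phi.
Proof.
have e1 : equiv (1 *: phi)%A phi by apply: equiv_axiom; exact: A8.
exact: equiv_trans (equiv_sym e1) e1.
Qed.

Lemma equivDC phi psi : equiv (phi + psi)%A (psi + phi)%A.
Proof. by apply: equiv_axiom; exact: A3. Qed.

Lemma equivDA phi psi theta :
  equiv (phi + (psi + theta))%A ((phi + psi) + theta)%A.
Proof. by apply: equiv_axiom; exact: A2. Qed.

Lemma equiv0D phi : equiv (areal 0 + phi)%A phi.
Proof. by apply: equiv_axiom; exact: A4. Qed.

Lemma equiv0Z phi : equiv (0 *: phi)%A (areal 0).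
Proof. by apply: equiv_axiom; exact: A9. Qed.

Lemma equivDl phi psi theta :
  equiv phi psi -> equiv (phi + theta)%A (psi + theta)%A.
Proof. by move=> [h k]; split; exact: provable_R1. Qed.

Lemma equivD phi phi' psi psi' :
  equiv phi phi' -> equiv psi psi' -> equiv (phi + psi)%A (phi' + psi')%A.
Proof.
move=> h k; apply: equiv_trans (equivDl _ h) _.
by apply: equiv_trans (equivDC _ _) (equiv_trans (equivDl _ k) (equivDC _ _)).
Qed.

Lemma equivDACA a b c d :
  equiv ((a + b) + (c + d))%A ((a + c) + (b + d) : affprop R P)%A.
Proof.
apply: equiv_trans (equiv_sym (equivDA _ _ _)) _.
apply: equiv_trans _ (equivDA _ _ _).
apply: equivD; first exact: equiv_refl.
apply: equiv_trans (equivDA _ _ _) (equiv_trans _ (equiv_sym (equivDA _ _ _))).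
by apply: equivDl; exact: equivDC.
Qed.

(** Cancellation is what lets equivalence pass to negative scalars, on which the
scaling rule says nothing. *)
Lemma equivNZK (r : R) phi theta :
  equiv ((- r) *: phi + (r *: phi + theta))%A theta.
Proof.
apply: equiv_trans (equivDA _ _ _) _.
apply: equiv_trans _ (equiv0D _); apply: equivDl.
apply: equiv_trans _ (equiv0Z phi); apply: equiv_sym; rewrite -(addNr r).
by apply: equiv_axiom; exact: A6.
Qed.

Lemma equivZ (r : R) phi psi :
  equiv phi psi -> equiv (r *: phi)%A (r *: psi)%A.
Proof.
have half a b : equiv a b -> provable (r *: a <= r *: b)%C.
  move=> [ab ba]; case: (lerP 0 r) => [r0|/ltW r0]; first exact: provable_scale.
  (* For a negative scalar, add [r a + r b] to both sides of [-r b <= -r a]. *)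
  have r0' : 0 <= - r by rewrite oppr_ge0.
  have h := provable_R1 (r *: a + r *: b)%A (provable_scale r0' ba).
  apply: provable_R3 (provable_R3 _ h) (equivNZK _ _ _).1.
  apply: (equiv_trans (equiv_sym (equivNZK r b (r *: a)%A)) _).1.
  by apply: equivD; [exact: equiv_refl|exact: equivDC].
by move=> h; split; apply: half => //; exact: equiv_sym.
Qed.

(** The coefficient of [phi] on [g], where [phi] is read as a formal linear
combination of atoms, boxes and the constant [1]. *)
Fixpoint coef g phi : R :=
  match phi with
  | AAdd phi psi => coef g phi + coef g psi
  | AScale r phi => r * coef g phi
  | phi => (phi == g)%:R
  end.

Fixpoint comb s phi : affprop R P :=
  if s is g :: s' then (coef g phi *: g + comb s' phi)%A else areal 0.

Fixpoint gens phi : seq (affprop R P) :=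
  match phi with
  | AAdd phi psi => gens phi ++ gens psi
  | AScale r phi => gens phi
  | phi => [:: phi]
  end.

Lemma combD s phi psi :
  equiv (comb s (phi + psi)%A) (comb s phi + comb s psi)%A.
Proof.
elim: s => [|g s IH] /=; first exact/equiv_sym/equiv0D.
apply: equiv_trans (equivDACA _ _ _ _); apply: equivD => //.
by apply: equiv_axiom; exact: A6.
Qed.

Lemma combZ s (r : R) phi : equiv (comb s (r *: phi)%A) (r *: comb s phi)%A.
Proof.
have ZZ (a b : R) psi : equiv ((a * b) *: psi)%A (a *: (b *: psi))%A.
  by apply/equiv_sym/equiv_axiom; exact: A7.
elim: s => [|g s IH] /=; first by rewrite /areal -{1}(mulr0 r); exact: ZZ.
have ZD : equiv (r *: (coef g phi *: g + comb s phi))%A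
    (r *: (coef g phi *: g) + r *: comb s phi)%A.
  by apply: equiv_axiom; exact: A5.
by apply: equiv_trans (equiv_sym ZD); apply: equivD.
Qed.

Lemma comb_gen s g : (forall h, coef h g = (g == h)%:R) -> uniq s ->
  equiv (comb s g) (if g \in s then g else areal 0).
Proof.
move=> cg; elim: s => [_|h s IH] /=; first exact: equiv_refl.
move=> /andP[hs us]; rewrite cg inE; have {IH} := IH us.
have [->|_] /= := eqVneq g h.
  rewrite (negbTE hs) => IH; apply: equiv_trans (equiv0D h).
  apply: equiv_trans (equivDC _ _); apply: equivD => //.
  by apply: equiv_axiom; exact: A8.
move=> IH; apply: equiv_trans (equiv0D _); apply: equivD => //.
exact: equiv0Z.
Qed.

Lemma comb_equiv s phi : uniq s -> {subset gens phi <= s} ->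
  equiv (comb s phi) phi.
Proof.
move=> us; elim: phi => [|p|phi IH1 psi IH2|r phi IH|phi _] sub.
- have := @comb_gen s AOne (fun=> erefl) us.
  by rewrite sub //= mem_head.
- have := @comb_gen s (AAtom p) (fun=> erefl) us.
  by rewrite sub //= mem_head.
- apply: equiv_trans (combD _ _ _) _; apply: equivD.
  + by apply: IH1 => g h; apply: sub; rewrite mem_cat h.
  + by apply: IH2 => g h; apply: sub; rewrite mem_cat h orbT.
- by apply: equiv_trans (combZ _ _ _) _; apply: equivZ; exact: IH.
- have := @comb_gen s (ABox phi) (fun=> erefl) us.
  by rewrite sub //= mem_head.
Qed.

Record linear_form (f : affprop R P -> R) : Prop := LinearForm {
  linear_formD : forall phi psi, f (phi + psi)%A = f phi + f psi ;
  linear_formZ : forall r phi, f (r *: phi)%A = r * f phi }.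

(** Among the linear forms are the coefficient maps [coef g], and these determine
the normal form [comb s phi] to which [phi] is provably equal. An identity
between propositions thereby becomes an identity of scalars, in which the values
of the linear form on the subterms are indeterminates. *)
Lemma provable_linear phi psi :
  (forall f, linear_form f -> f phi = f psi) -> provable (phi <= psi)%C.
Proof.
move=> h; pose s := undup (gens phi ++ gens psi).
have us : uniq s by exact: undup_uniq.
suff e : comb s phi = comb s psi.
  have [_ h1] : equiv (comb s phi) phi.
    by apply: comb_equiv => // g; rewrite mem_undup mem_cat => ->.
  have [h2 _] : equiv (comb s psi) psi.
    by apply: comb_equiv => // g; rewrite mem_undup mem_cat orbC => ->.
  by apply: provable_R3 h1 _; rewrite e.
elim: s {us} => //= g s ->; congr (AAdd (AScale _ _) _).
by apply: h; split.
Qed.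

(** Farkas-style certificate: the slack [psi - phi] is exhibited as a nonnegative
combination of the slacks of two derived conditions. *)
Lemma proves_lincomb2 (r s : R) a b c d phi psi Gamma : 0 <= r -> 0 <= s ->
  proves Gamma (a <= b)%C -> proves Gamma (c <= d)%C ->
  (forall f, linear_form f ->
    f psi - f phi = r * (f b - f a) + s * (f d - f c)) ->
  proves Gamma (phi <= psi)%C.
Proof.
move=> r0 s0 ab cd h; pose e := (phi - (r *: a + s *: c))%A.
have lin x y : (forall f, linear_form f -> f x = f y) ->
    proves Gamma (x <= y)%C.
  by move=> xy; apply/provable_proves/provable_linear.
apply: (@proves_R3 _ _ _ _ ((r *: a + s *: c) + e)%A).
  by apply: lin => f [fD fZ]; rewrite !(fD, fZ); ring.
apply: (@proves_R3 _ _ _ _ ((r *: b + s *: c) + e)%A).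
  by do 2 apply: proves_R1; exact: proves_scale.
apply: (@proves_R3 _ _ _ _ ((r *: b + s *: d) + e)%A).
  apply: proves_R1; apply: (@proves_R3 _ _ _ _ (s *: c + r *: b)%A).
    by apply: lin => f [fD fZ]; rewrite !(fD, fZ); ring.
  apply: (@proves_R3 _ _ _ _ (s *: d + r *: b)%A).
    by apply: proves_R1; exact: proves_scale.
  by apply: lin => f [fD fZ]; rewrite !(fD, fZ); ring.
apply: lin => f lf; have := h f lf; case: lf => fD fZ; rewrite !(fD, fZ); lra.
Qed.

Lemma proves_lincomb1 (r : R) a b phi psi Gamma : 0 <= r ->
  proves Gamma (a <= b)%C ->
  (forall f, linear_form f -> f psi - f phi = r * (f b - f a)) ->
  proves Gamma (phi <= psi)%C.
Proof.
move=> r0 ab h; apply: (proves_lincomb2 r0 (lexx 0) ab ab) => f /h ->.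
by rewrite mul0r addr0.
Qed.

Lemma provable_lincomb1 (r : R) a b phi psi : 0 <= r ->
  provable (a <= b)%C ->
  (forall f, linear_form f -> f psi - f phi = r * (f b - f a)) ->
  provable (phi <= psi)%C.
Proof.
move=> r0 ab h; apply: proves0.
exact: proves_lincomb1 r0 (provable_proves _ ab) h.
Qed.

Lemma provable_lincomb2 (r s : R) a b c d phi psi : 0 <= r -> 0 <= s ->
  provable (a <= b)%C -> provable (c <= d)%C ->
  (forall f, linear_form f ->
    f psi - f phi = r * (f b - f a) + s * (f d - f c)) ->
  provable (phi <= psi)%C.
Proof.
move=> r0 s0 ab cd h; apply: proves0.
by apply: (proves_lincomb2 r0 s0 _ _ h); exact: provable_proves.
Qed.

End Linear.

(* Turns a goal quantified over linear forms into an identity of scalars. *)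
Ltac lin := let f := fresh "f" in let fD := fresh "fD" in
  let fZ := fresh "fZ" in
  move=> f [fD fZ]; rewrite /areal !(fD, fZ).

(** * Bounds and the deduction theorem *)

Section Bounds.
Variables (R : realType) (P : countType).
Implicit Types (phi psi theta : affprop R P) (c d : condition R P).
Implicit Types (Gamma Delta : theory R P).

(** The constant [1] is an order unit. For a box the lower bound is carried
through the box by monotonicity, as real constants are fixed by it. *)
Lemma provable_bounds phi : exists K : R, [/\ 0 <= K,
  provable (areal (- K) <= phi)%C & provable (phi <= areal K)%C].
Proof.
elim: phi => [|p|phi [K [K0 h k]] psi [L [L0 h' k']]|r phi [K [K0 h k]]|
              phi [K [K0 h k]]].
- have hA : @provable R P (areal (-1) <= areal 1)%C.
    by apply/provable_axiom/A1; lra.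
  exists 1; split => //; [apply: provable_lincomb1 ler01 hA _|
     apply: provable_lincomb1 (lexx 0) hA _]; lin; ring.
- have h0 : @provable R P (areal 0 <= AAtom p)%C.
    by apply: provable_axiom; exact: A10_ge0.
  have h1 : @provable R P (AAtom p <= AOne)%C.
    by apply: provable_axiom; exact: A10_le1.
  have hA : @provable R P (areal (-1) <= areal 0)%C.
    by apply/provable_axiom/A1; lra.
  exists 1; split => //; first exact: provable_R3 hA h0.
  by apply: provable_lincomb1 ler01 h1 _; lin; ring.
- exists (K + L); split; first by rewrite addr_ge0.
  + by apply: (provable_lincomb2 ler01 ler01 h h'); lin; ring.
  + by apply: (provable_lincomb2 ler01 ler01 k k'); lin; ring.
- exists (`|r| * K); split; first by rewrite mulr_ge0.
  + have [r0|/ltW r0] := ger0P r.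
      by apply: (provable_lincomb1 r0 h); lin; ring.
    by rewrite -oppr_ge0 in r0; apply: (provable_lincomb1 r0 k); lin; ring.
  + have [r0|/ltW r0] := ger0P r.
      by apply: (provable_lincomb1 r0 k); lin; ring.
    by rewrite -oppr_ge0 in r0; apply: (provable_lincomb1 r0 h); lin; ring.
- exists K; split => //; last first.
    apply: (provable_R3 _ k); apply: provable_axiom; exact: A12.
  apply: provable_R3 _ (provable_R4 h).
  by apply: provable_axiom; apply: (@A15 _ _ (- K)); right.
Qed.

(** A false inequality between constants, suitably scaled, exceeds the order-unit
bound on [psi - phi]. *)
Lemma proves_explosion Gamma (r s : R) phi psi : s < r ->
  proves Gamma (areal r <= areal s)%C -> proves Gamma (phi <= psi)%C.
Proof.
move=> sr h; have [K [K0 k _]] := provable_bounds (psi - phi)%A.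
have c0 : 0 <= K / (r - s) by rewrite divr_ge0 // subr_ge0 ltW.
apply: (proves_lincomb2 ler01 c0 (provable_proves _ k) h); lin.
by field; lra.
Qed.

(** The weight [mu] counts how often the hypothesis is used. The premise
[0 <= r] of the scaling rule may itself rest on the hypothesis; when [r < 0]
that premise refutes the hypothesis outright, and a large enough weight absorbs
any bounded error. *)
Lemma deduction Gamma x y c : proves (Gamma `|` [set (x <= y)%C]) c ->
  exists2 mu : R, 0 <= mu &
    proves Gamma (lhs c + mu *: y <= rhs c + mu *: x)%C.
Proof.
move: c; apply: proves_elim => /=.
- move=> [a b] h; exists 0 => //=.
  by apply: (proves_lincomb1 ler01 (provable_proves _ h)); lin; ring.
- move=> c [Gc|->]; last first.
    exists 1 => //=; apply/provable_proves/provable_linear.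
    by lin; ring.
  exists 0 => //=; case: c Gc => a b Gc.
  by apply: (proves_lincomb1 ler01 (proves_hyp Gc)); lin; ring.
- move=> phi psi theta [mu mu0 h]; exists mu => //.
  by apply: (proves_lincomb1 ler01 h); lin; ring.
- move=> r phi psi [mu mu0 h] [nu nu0 k]; case: (lerP 0 r) => r0.
    exists (r * nu); first exact: mulr_ge0.
    by apply: (proves_lincomb1 r0 k); lin; ring.
  have [K [K0 b _]] := provable_bounds (r *: psi - r *: phi)%A.
  have c0 : 0 <= K / - r by rewrite divr_ge0 // oppr_ge0 ltW.
  exists (K / - r * mu); first exact: mulr_ge0.
  apply: (proves_lincomb2 ler01 c0 (provable_proves _ b) h); lin.
  by field; rewrite lt_eqF.
- move=> phi psi theta [mu mu0 h] [nu nu0 k].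
  exists (mu + nu); first exact: addr_ge0.
  by apply: (proves_lincomb2 ler01 ler01 h k); lin; ring.
Qed.

End Bounds.

(** * Maximal theories are linear functionals *)

Section States.
Variables (R : realType) (P : countType).
Implicit Types (phi psi theta : affprop R P) (c d : condition R P).
Implicit Types (Gamma Delta Theta : theory R P).

Record is_state (T : affprop R P -> R) : Prop := IsState {
  state_linear : linear_form T ;
  state1 : T AOne = 1 ;
  state_le : forall phi psi, provable (phi <= psi)%C -> T phi <= T psi }.

(** Derivations are finite, hence use a single member of a chain. The first
alternative is needed for the empty chain. *)
Lemma proves_bigcup Gamma (F : set (theory R P)) c : total_on F subset ->
  proves (Gamma `|` \bigcup_(Delta in F) Delta) c ->
  proves Gamma c \/ exists2 Delta, F Delta & proves (Gamma `|` Delta) c.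
Proof.
move=> Ftot.
pose Q c := proves Gamma c \/
  exists2 Delta, F Delta & proves (Gamma `|` Delta) c.
have joint c1 c2 c3 : (forall Delta, proves Delta c1 -> proves Delta c2 ->
    proves Delta c3) -> Q c1 -> Q c2 -> Q c3.
  move=> rule [h1|[D1 F1 h1]] [h2|[D2 F2 h2]].
  - by left; exact: rule.
  - by right; exists D2 => //; apply: rule h2; apply: proves_sub h1.
  - by right; exists D1 => //; apply: rule h1 _; apply: proves_sub h2.
  - case: (Ftot _ _ F1 F2) => sub; right.
    + by exists D2 => //; apply: rule h2; apply: proves_sub h1; exact: setUS.
    + by exists D1 => //; apply: rule h1 _; apply: proves_sub h2; exact: setUS.
apply: (proves_elim (Q := Q)).
- by move=> d pd; left; exact: provable_proves.
- move=> d [Gd|[D FD Dd]]; first by left; exact: proves_hyp.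
  by right; exists D => //; apply: proves_hyp; right.
- move=> phi psi theta hQ; apply: (joint _ _ _ _ hQ hQ) => D h _.
  exact: proves_R1.
- by move=> r phi psi; apply: joint => D; exact: proves_R2.
- by move=> phi psi theta; apply: joint => D; exact: proves_R3.
Qed.

Lemma exists_maximal Gamma c : ~ proves Gamma c -> exists Theta,
  [/\ Gamma `<=` Theta, ~ proves Theta c &
      forall d, ~ proves Theta d -> proves (Theta `|` [set d]) c].
Proof.
move=> nc.
have [|D [nD maxD]] := @Zorn_bigcup _ [set D | ~ proves (Gamma `|` D) c].
  move=> F FP Ftot /(proves_bigcup Ftot) [//|[D /FP]]; exact.
exists (Gamma `|` D); split => // d nd.
apply: contrapT => nDd; apply: (maxD (D `|` [set d])); last by rewrite /= setUA.
split; first by move=> x; left.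
by move=> /(_ d (or_intror erefl)) Dd; apply: nd; apply: proves_hyp; right.
Qed.

(** If neither [x <= y] nor [y <= x] is derivable, maximality and the deduction
theorem give [phi - a >= m (y - x)] and [phi - a >= n (x - y)] with [m, n >= 0];
the combination with weights [n] and [m] cancels [x] and [y]. *)
Lemma maximal_total Theta a phi : ~ proves Theta (a <= phi)%C ->
  (forall d, ~ proves Theta d -> proves (Theta `|` [set d]) (a <= phi)%C) ->
  forall x y, proves Theta (x <= y)%C \/ proves Theta (y <= x)%C.
Proof.
move=> na max x y.
have [|/max/deduction/= [m m0 h]] := EM (proves Theta (x <= y)%C).
  by left.
have [|/max/deduction/= [n n0 k]] := EM (proves Theta (y <= x)%C).
  by right.
(* The weights sum to zero only if [n = 0], and then the second bound suffices. *)
case: na; have [n00|nn0] := eqVneq n 0.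
  by apply: (proves_lincomb1 ler01 k); lin; rewrite n00; ring.
have mn0 : 0 < m + n by rewrite ltr_wpDl // lt_def nn0.
have c1 : 0 <= n / (m + n) by rewrite divr_ge0 // ltW.
have c2 : 0 <= m / (m + n) by rewrite divr_ge0 // ltW.
apply: (proves_lincomb2 c1 c2 h k); lin; field.
by rewrite gt_eqF.
Qed.

Section StateOfTheory.
Variables (Theta : theory R P) (c0 : condition R P).
Hypothesis consistent : ~ proves Theta c0.
Hypothesis total : forall x y,
  proves Theta (x <= y)%C \/ proves Theta (y <= x)%C.

Definition state_of phi := sup [set r : R | proves Theta (areal r <= phi)%C].

Lemma proves_areal (r s : R) : proves Theta (areal r <= areal s)%C -> r <= s.
Proof.
move=> h; rewrite leNgt; apply/negP => sr; apply: consistent.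
by case: c0 => a b; exact: proves_explosion sr h.
Qed.

(** Totality yields the upper bound: [state_of phi + e <= phi] is excluded by the
definition of the supremum. *)
Lemma state_of_approx phi (e : R) : 0 < e ->
  proves Theta (areal (state_of phi - e) <= phi)%C /\
  proves Theta (phi <= areal (state_of phi + e))%C.
Proof.
move=> e0; have [K [_ lb ub]] := provable_bounds phi.
have hs : has_sup [set r : R | proves Theta (areal r <= phi)%C].
  split; first by exists (- K); exact: provable_proves.
  exists K => r /= h; apply: proves_areal; apply: proves_R3 h _.
  exact: provable_proves.
split.
  have [r /= h lt] := sup_adherent e0 hs; apply: proves_R3 h.
  by apply: provable_proves; apply: provable_axiom; apply: A1; exact: ltW.
case: (total phi (areal (state_of phi + e))) => // h.
have /= : state_of phi + e <= state_of phi by apply: ub_le_sup => //; case: hs.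
by rewrite gerDl leNgt e0.
Qed.

(** The value of a proposition need only be computed up to every positive error;
additivity, homogeneity and normalization all follow from this. *)
Lemma state_of_unique phi (t : R) :
  (forall e, 0 < e -> proves Theta (areal (t - e) <= phi)%C /\
    proves Theta (phi <= areal (t + e))%C) -> state_of phi = t.
Proof.
move=> h; apply/eqP; rewrite eq_le; apply/andP.
split; apply/ler_addgt0Pr => e e0.
  have e2 : 0 < e / 2 by rewrite divr_gt0.
  have [k _] := state_of_approx phi e2; have [_ l] := h _ e2.
  have := proves_areal (proves_R3 k l); lra.
have e2 : 0 < e / 2 by rewrite divr_gt0.
have [_ k] := state_of_approx phi e2; have [l _] := h _ e2.
have := proves_areal (proves_R3 l k); lra.
Qed.

Lemma state_of_le phi psi :
  proves Theta (phi <= psi)%C -> state_of phi <= state_of psi.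
Proof.
move=> h; apply/ler_addgt0Pr => e e0.
have e2 : 0 < e / 2 by rewrite divr_gt0.
have [k _] := state_of_approx phi e2; have [_ l] := state_of_approx psi e2.
have := proves_areal (proves_R3 k (proves_R3 h l)); lra.
Qed.

Lemma state_of_areal (t : R) : state_of (areal t) = t.
Proof.
by apply: state_of_unique => e e0; split; apply: provable_proves;
  apply: provable_axiom; apply: A1; rewrite ?lerDl ?gerBl ltW.
Qed.

Lemma state_of_is_state : is_state state_of.
Proof.
split; last by move=> phi psi h; apply: state_of_le; exact: provable_proves.
- split=> [phi psi|r phi]; apply: state_of_unique => e e0.
    have e2 : 0 < e / 2 by rewrite divr_gt0.
    have [k1 k2] := state_of_approx phi e2.
    have [l1 l2] := state_of_approx psi e2; split.
    + by apply: (proves_lincomb2 ler01 ler01 k1 l1); lin; field.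
    + by apply: (proves_lincomb2 ler01 ler01 k2 l2); lin; field.
  have r1 : 0 < `|r| + 1 by rewrite ltr_wpDl.
  have er : 0 < e / (`|r| + 1) by rewrite divr_gt0.
  have re : `|r| * (e / (`|r| + 1)) <= e.
    by rewrite mulrA ler_pdivrMr // mulrC ler_pM2l // lerDl.
  have one (s : R) : 0 <= s -> proves Theta (areal 0 <= areal s)%C.
    by move=> s0; apply/provable_proves/provable_axiom/A1.
  (* [k1] and [k2] only reach the error [|r| * (e / (|r| + 1))]; [gap] is the
     second slack that raises it to [e] in the certificates below. *)
  have gap : proves Theta (areal 0 <= areal (e - `|r| * (e / (`|r| + 1))))%C.
    by apply: one; rewrite subr_ge0.
  have [k1 k2] := state_of_approx phi er; split.
  + have [r0|/ltW r0] := ger0P r.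
      by apply: (proves_lincomb2 r0 ler01 k1 gap); lin;
        rewrite ger0_norm //; ring.
    rewrite -oppr_ge0 in r0.
    by apply: (proves_lincomb2 r0 ler01 k2 gap); lin;
      rewrite -normrN ger0_norm //; ring.
  + have [r0|/ltW r0] := ger0P r.
      by apply: (proves_lincomb2 r0 ler01 k2 gap); lin;
        rewrite ger0_norm //; ring.
    rewrite -oppr_ge0 in r0.
    by apply: (proves_lincomb2 r0 ler01 k1 gap); lin;
      rewrite -normrN ger0_norm //; ring.
- rewrite -[RHS](state_of_areal 1); apply/eqP; rewrite eq_le.
  by apply/andP; split; apply: state_of_le;
    apply/provable_proves/provable_linear; lin; ring.
Qed.

End StateOfTheory.

(** Hahn-Banach for the cone of derivable conditions. The theory chosen is maximal
among those not deriving [a <= phi], so totality puts [phi <= a] in it. *)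
Lemma separation Gamma (a : R) phi : ~ proves Gamma (areal a <= phi)%C ->
  exists T, [/\ is_state T, T phi <= a &
    forall c, Gamma c -> T (lhs c) <= T (rhs c)].
Proof.
move=> na; have [Theta [sub nT max]] := exists_maximal na.
have tot := maximal_total nT max.
exists (state_of Theta); split.
- exact: state_of_is_state nT tot.
- rewrite -[leRHS](state_of_areal nT tot); apply: (state_of_le nT tot).
  by case: (tot (areal a) phi).
- by move=> [x y] /sub h; apply: (state_of_le nT tot); exact: proves_hyp.
Qed.

End States.

(** * States above a given state *)

Section BoxedStates.
Variables (R : realType) (P : countType).
Implicit Types (phi psi theta : affprop R P) (c d : condition R P).
Variable (T : affprop R P -> R).
Hypothesis sT : is_state T.

Let TD phi psi : T (phi + psi)%A = T phi + T psi.
Proof. by case: sT => -[]. Qed.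

Let TZ (r : R) phi : T (r *: phi)%A = r * T phi.
Proof. by case: sT => -[]. Qed.

Let T1 : T AOne = 1. Proof. by case: sT. Qed.

Let Tle phi psi : provable (phi <= psi)%C -> T phi <= T psi.
Proof. by case: sT => _ _; exact. Qed.

Lemma state_areal (r : R) : T (areal r) = r.
Proof. by rewrite /areal TZ T1 mulr1. Qed.

Lemma state_box_areal (r : R) : T ([box] areal r)%A = r.
Proof.
rewrite -[RHS]state_areal; apply/eqP; rewrite eq_le.
by apply/andP; split; apply: Tle; apply: provable_axiom; apply: (A15 (r := r));
  [left|right].
Qed.

Lemma state_box_le phi : T ([box] phi)%A <= T phi.
Proof. by apply: Tle; apply: provable_axiom; exact: A12. Qed.

Lemma state_box_box phi : T ([box] phi)%A <= T ([box] [box] phi)%A.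
Proof. by apply: Tle; apply: provable_axiom; exact: A13. Qed.

Lemma state_box_mono phi psi :
  provable (phi <= psi)%C -> T ([box] phi)%A <= T ([box] psi)%A.
Proof. by move=> h; apply: Tle; exact: provable_R4. Qed.

Lemma state_boxB phi psi :
  T ([box] (phi - psi))%A <= T ([box] phi)%A - T ([box] psi)%A.
Proof.
rewrite -[- T _]mulN1r -TZ -TD.
by apply: Tle; apply: provable_axiom; exact: A11.
Qed.

(** Superadditivity of the box, obtained from the subtraction axiom applied to
[(phi + psi) - psi]. *)
Lemma state_boxD phi psi :
  T ([box] phi)%A + T ([box] psi)%A <= T ([box] (phi + psi))%A.
Proof.
rewrite -lerBrDr; apply: le_trans (state_boxB _ _).
by apply: state_box_mono; apply: provable_linear; lin; ring.
Qed.

Lemma state_boxZ (r : R) phi :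
  0 <= r -> r * T ([box] phi)%A <= T ([box] (r *: phi))%A.
Proof.
by move=> r0; rewrite -TZ; apply: Tle; apply: provable_axiom;
  apply: (A14 (phi := phi) r0); right.
Qed.

(** The map [a |-> T (box a)] is superlinear, so the pairs whose difference has a
nonnegative image form a theory closed under derivation. In the scaling rule the
premise [0 <= r] belongs to this theory only when [r] is truly nonnegative. *)
Lemma state_box_proves c :
  proves [set c | 0 <= T ([box] (rhs c - lhs c))%A] c ->
  0 <= T ([box] (rhs c - lhs c))%A.
Proof.
move: c; apply: proves_elim => //=.
- move=> [phi psi] h /=; rewrite -[leLHS](state_box_areal 0).
  apply: state_box_mono; apply: (provable_lincomb1 ler01 h); lin; ring.
- move=> phi psi theta h; apply: le_trans h _.
  by apply: state_box_mono; apply: provable_linear; lin; ring.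
- move=> r phi psi r0 h.
  have {}r0 : 0 <= r.
    by have := le_trans r0 (state_boxB _ _); rewrite !state_box_areal subr0.
  apply: le_trans (mulr_ge0 r0 h) _; apply: le_trans (state_boxZ _ r0) _.
  by apply: state_box_mono; apply: provable_linear; lin; ring.
- move=> phi psi theta h k; apply: le_trans (addr_ge0 h k) _.
  apply: le_trans (state_boxD _ _) _.
  by apply: state_box_mono; apply: provable_linear; lin; ring.
Qed.

(** The theory of [state_box_proves] contains [T (box psi) <= box psi] for every
[psi], by the transitivity axiom of the box; this places its states above [T]. *)
Lemma box_witness phi (e : R) : 0 < e -> exists T', [/\ is_state T',
  forall psi, T ([box] psi)%A <= T' ([box] psi)%A &
  T' phi <= T ([box] phi)%A + e].
Proof.
move=> e0; have [|T' [sT' le hT']] := @separation R P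
    [set c | 0 <= T ([box] (rhs c - lhs c))%A] (T ([box] phi)%A + e) phi.
  move=> /state_box_proves /= /le_trans/(_ (state_boxB _ _)).
  by rewrite state_box_areal opprD addNKr oppr_ge0 leNgt e0.
exists T'; split => // psi.
have := hT' (areal (T ([box] psi)%A) <= [box] psi)%C.
have [[_ ZT'] T'1 _] := sT'.
rewrite /areal /= ZT' T'1 mulr1; apply.
apply: le_trans (state_boxD _ _).
have -> : T ([box] (-1 *: (T ([box] psi)%A *: AOne)))%A = - T ([box] psi)%A.
  rewrite -[RHS]state_box_areal; apply/eqP; rewrite eq_le.
  by apply/andP; split; apply: state_box_mono; apply: provable_linear;
    lin; ring.
by rewrite subr_ge0 state_box_box.
Qed.

End BoxedStates.

Definition state (R : realType) (P : countType) :=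
  {T : affprop R P -> R | is_state T}.

HB.instance Definition _ (R : realType) (P : countType) :=
  gen_eqMixin (state R P).
HB.instance Definition _ (R : realType) (P : countType) :=
  gen_choiceMixin (state R P).

(** * The canonical model *)

Section CanonicalModel.
Variables (R : realType) (P : countType).
Implicit Types (S T : state R P) (phi psi : affprop R P).

Definition box_le T S :=
  forall psi, sval T ([box] psi)%A <= sval S ([box] psi)%A.

Definition box_upset (A : set (state R P)) :=
  forall T S, A T -> box_le T S -> A S.

Lemma box_upsetT : box_upset setT. Proof. by []. Qed.

Lemma box_upsetI : setI_closed box_upset.
Proof.
move=> A B uA uB T S [AT BT] TS; split; first exact: uA TS.
exact: uB TS.
Qed.

Lemma box_upset_bigU (I : Type) (f : I -> set (state R P)) :
  (forall i, box_upset (f i)) -> box_upset (\bigcup_i f i).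
Proof. by move=> uf T S [i _ fT] TS; exists i => //; exact: uf TS. Qed.

HB.instance Definition _ := isOpenTopological.Build (state R P)
  box_upsetT box_upsetI box_upset_bigU.

Lemma state_atom_itv (p : P) T : 0 <= sval T (AAtom p) <= 1.
Proof.
have [lT T1 Tle] := svalP T; apply/andP; split.
  rewrite -[leLHS](state_areal (svalP T)); apply: Tle.
  by apply: provable_axiom; exact: A10_ge0.
by rewrite -T1; apply: Tle; apply: provable_axiom; exact: A10_le1.
Qed.

Definition canonical : topmodel R P := @TopModel R P (state R P)
  (fun p T => sval T (AAtom p)) state_atom_itv.

End CanonicalModel.

(** For [f] bounded below, the infimum over a smaller neighbourhood is larger, so
the supremum is reached at the least one. *)
Lemma lsc_env_least (R : realType) (X : topologicalType) (f : X -> R) (x : X)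
    (U : set X) (K : R) : (forall y, K <= f y) -> open U -> U x ->
  (forall V, open V -> V x -> U `<=` V) -> lsc_env f x = inf (f @` U).
Proof.
move=> Kf oU Ux least; apply/eqP; rewrite eq_le; apply/andP; split.
  apply: ge_sup; first by exists (inf (f @` U)), U.
  move=> _ [V [oV Vx] <-]; apply: lb_le_inf; first by exists (f x), x.
  move=> _ [y Uy <-]; apply: ge_inf; last by exists y => //; exact: least Uy.
  by exists K => _ [z _ <-].
apply: ub_le_sup; last by exists U.
exists (f x) => _ [V [_ Vx] <-]; apply: ge_inf; last by exists x.
by exists K => _ [z _ <-].
Qed.

Section Truth.
Variables (R : realType) (P : countType).

Lemma canonical_truth (phi : affprop R P) (T : canonical R P) :
  value (canonical R P) phi T = sval T phi.
Proof.
elim: phi T => [|p|phi IH1 psi IH2|r phi IH|phi IH] T //=.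
- by case: (svalP T).
- by rewrite IH1 IH2; case: (svalP T) => -[].
- by rewrite IH; case: (svalP T) => -[].
have -> : value (canonical R P) phi = fun S => sval S phi by apply/funext.
have [K [_ lb _]] := provable_bounds phi.
rewrite (@lsc_env_least _ _ _ _ [set S | box_le T S] (- K)).
- apply/eqP; rewrite eq_le; apply/andP; split.
    apply/ler_addgt0Pr => e e0.
    have [T' [sT' TT' le]] := box_witness (svalP T) phi e0.
    apply: le_trans le; apply: ge_inf; last by exists (exist _ T' sT').
    exists (- K) => _ [S _ <-]; rewrite -[leLHS](state_areal (svalP S)).
    by apply: state_le lb; exact: svalP.
  apply: lb_le_inf; first by exists (sval T phi), T => // psi.
  move=> _ [S TS <-]; apply: le_trans (TS phi) _.
  exact: state_box_le (svalP S) _.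
- move=> S; rewrite -[leLHS](state_areal (svalP S)).
  by apply: state_le lb; exact: svalP.
- by move=> S S' TS SS' psi; apply: le_trans (TS psi) (SS' psi).
- by move=> psi.
- by move=> V oV VT S TS; exact: oV TS.
Qed.

End Truth.

Theorem theorem4p4 (R : realType) (P : countType) (Gamma : theory R P)
    (phi : affprop R P) :
  entails Gamma (areal 0 <= phi)%C ->
  forall n : nat, (1 <= n)%N -> proves Gamma (areal (- (1 / n%:R)) <= phi)%C.
Proof.
move=> valid n n1; apply: contrapT => /separation[T [sT Tphi TG]].
pose x : canonical R P := exist _ T sT.
have := valid (canonical R P) x; rewrite /sat_cond /sat_theory.
have sat : sat_theory x Gamma.
  by move=> c /TG; rewrite /sat_cond !canonical_truth.
move=> /(_ sat); rewrite /sat_cond !canonical_truth /= (state_areal sT) leNgt.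
by rewrite (le_lt_trans Tphi) // oppr_lt0 divr_gt0 // ltr0n.
Qed.
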